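(* Every monogenic semi-monoidal category with a self-similar generating object is semi-monoidally equivalent to a semi-monoidal monoid.
   Context: A semi-monoidal category is a category $\mathcal C$ with a functor $\otimes:\mathcal C\times\mathcal C\to\mathcal C$ and natural isomorphisms $\tau_{X,Y,Z}:X\otimes(Y\otimes Z)\to(X\otimes Y)\otimes Z$ satisfying MacLane's pentagon condition; no unit object is assumed. Standing convention: every object $A$ of a semi-monoidal category is faithful, i.e. the functors $A\otimes\_$ and $\_\otimes A$ are faithful. A functor between semi-monoidal categories that (strictly) preserves the tensor is a (strict) semi-monoidal functor, and a semi-monoidal equivalence is an equivalence of categories in the evident semi-monoidal sense. A semi-monoidal category is monogenic, with generating object $S$, when every object is obtained from $S$ by iterated application of $\otimes$. An object $S$ is self-similar when there is an isomorphism $S\otimes S\cong S$. A semi-monoidal monoid is a semi-monoidal category with a single object. *)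

(* Defs.v *)
Set Implicit Arguments.
Unset Strict Implicit.
Unset Printing Implicit Defensive.

Declare Scope cat_scope.
Delimit Scope cat_scope with cat.
Local Open Scope cat_scope.

Record Category := {
  Ob :> Type;
  Hom : Ob -> Ob -> Type;
  idm : forall X, Hom X X;
  comp : forall X Y Z, Hom Y Z -> Hom X Y -> Hom X Z;
  comp_idl : forall X Y (f : Hom X Y), comp (idm Y) f = f;
  comp_idr : forall X Y (f : Hom X Y), comp f (idm X) = f;
  compA : forall X Y Z W (h : Hom Z W) (g : Hom Y Z) (f : Hom X Y),
    comp h (comp g f) = comp (comp h g) f
}.

Arguments Hom {c} X Y.
Arguments idm {c} X.

Notation "g ∘ f" := (comp g f) (at level 40, left associativity) : cat_scope.

Definition is_iso (C : Category) (X Y : C) (f : Hom X Y) : Prop :=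
  exists g : Hom Y X, g ∘ f = idm X /\ f ∘ g = idm Y.

Record Functor (C D : Category) := {
  fobj :> C -> D;
  fmap : forall X Y : C, Hom X Y -> Hom (fobj X) (fobj Y);
  fmap_id : forall X, fmap (idm X) = idm (fobj X);
  fmap_comp : forall (X Y Z : C) (g : Hom Y Z) (f : Hom X Y),
    fmap (g ∘ f) = fmap g ∘ fmap f
}.

Arguments fmap {C D} F {X Y} f : rename.

Definition id_functor (C : Category) : Functor C C :=
  {| fobj := fun X => X;
     fmap := fun _ _ f => f;
     fmap_id := fun _ => eq_refl;
     fmap_comp := fun _ _ _ _ _ => eq_refl |}.

Program Definition comp_functor (C D E : Category)
    (G : Functor D E) (F : Functor C D) : Functor C E :=
  {| fobj := fun X => G (F X);
     fmap := fun _ _ f => fmap G (fmap F f) |}.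
Next Obligation. cbn; intros; now rewrite !fmap_id. Qed.
Next Obligation. cbn; intros; now rewrite !fmap_comp. Qed.

Program Definition prod_category (C D : Category) : Category :=
  {| Ob := (C * D)%type;
     Hom := fun X Y => (Hom (fst X) (fst Y) * Hom (snd X) (snd Y))%type;
     idm := fun X => (idm (fst X), idm (snd X));
     comp := fun _ _ _ g f => (fst g ∘ fst f, snd g ∘ snd f) |}.
Next Obligation. cbn; intros; destruct f; cbn; now rewrite !comp_idl. Qed.
Next Obligation. cbn; intros; destruct f; cbn; now rewrite !comp_idr. Qed.
Next Obligation. cbn; intros; now rewrite !compA. Qed.

Section Tensor.
Variables (C : Category) (T : Functor (prod_category C C) C).

Definition bimap_ob (X Y : C) : C := T (X, Y).

Definition bimap (X X' Y Y' : C) (f : Hom X X') (g : Hom Y Y') :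
    Hom (bimap_ob X Y) (bimap_ob X' Y') :=
  @fmap _ _ T (X, Y) (X', Y') (f, g).

(* The functors A ⊗ _ and _ ⊗ A are faithful. *)
Definition faithful_object (A : C) : Prop :=
  (forall (X Y : C) (f g : Hom X Y),
     bimap (idm A) f = bimap (idm A) g -> f = g) /\
  (forall (X Y : C) (f g : Hom X Y),
     bimap f (idm A) = bimap g (idm A) -> f = g).

Lemma bimap_id (X Y : C) : bimap (idm X) (idm Y) = idm (bimap_ob X Y).
Proof. exact (fmap_id T (X, Y)). Qed.

Lemma bimap_comp (X X' X'' Y Y' Y'' : C)
    (f' : Hom X' X'') (f : Hom X X') (g' : Hom Y' Y'') (g : Hom Y Y') :
  bimap (f' ∘ f) (g' ∘ g) = bimap f' g' ∘ bimap f g.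
Proof.
exact (@fmap_comp _ _ T (X, Y) (X', Y') (X'', Y'') (f', g') (f, g)).
Qed.
End Tensor.

Record SemiMonoidalCategory := {
  smc_cat :> Category;
  tensor : Functor (prod_category smc_cat smc_cat) smc_cat;
  assoc : forall X Y Z : smc_cat,
    Hom (bimap_ob tensor X (bimap_ob tensor Y Z))
        (bimap_ob tensor (bimap_ob tensor X Y) Z);
  assoc_iso : forall X Y Z, is_iso (assoc X Y Z);
  assoc_natural : forall (X X' Y Y' Z Z' : smc_cat)
      (f : Hom X X') (g : Hom Y Y') (h : Hom Z Z'),
    assoc X' Y' Z' ∘ bimap tensor f (bimap tensor g h)
    = bimap tensor (bimap tensor f g) h ∘ assoc X Y Z;
  pentagon : forall W X Y Z : smc_cat,
    assoc (bimap_ob tensor W X) Y Z ∘ assoc W X (bimap_ob tensor Y Z)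
    = bimap tensor (assoc W X Y) (idm Z)
      ∘ assoc W (bimap_ob tensor X Y) Z
      ∘ bimap tensor (idm W) (assoc X Y Z);
  all_faithful : forall A : smc_cat, faithful_object tensor A
}.

Arguments assoc {s} X Y Z.

Notation "X ⊗ Y" := (bimap_ob (tensor _) X Y)
  (at level 35, right associativity) : cat_scope.
Notation "f ⊗₁ g" := (bimap (tensor _) f g)
  (at level 35, right associativity) : cat_scope.

(* Preservation of the tensor is up to coherent natural isomorphism; the
   strict case is the one where every [mu X Y] is an identity. *)
Record SemiMonoidalFunctor (C D : SemiMonoidalCategory) := {
  smf_functor :> Functor C D;
  mu : forall X Y : C,
    Hom (smf_functor X ⊗ smf_functor Y) (smf_functor (X ⊗ Y));
  mu_iso : forall X Y, is_iso (mu X Y);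
  mu_natural : forall (X X' Y Y' : C) (f : Hom X X') (g : Hom Y Y'),
    mu X' Y' ∘ (fmap smf_functor f ⊗₁ fmap smf_functor g)
    = fmap smf_functor (f ⊗₁ g) ∘ mu X Y;
  mu_assoc : forall X Y Z : C,
    fmap smf_functor (assoc X Y Z) ∘ mu X (Y ⊗ Z)
      ∘ (idm (smf_functor X) ⊗₁ mu Y Z)
    = mu (X ⊗ Y) Z ∘ (mu X Y ⊗₁ idm (smf_functor Z))
      ∘ assoc (smf_functor X) (smf_functor Y) (smf_functor Z)
}.

Arguments mu {C D} F X Y : rename.

Lemma is_iso_id (C : Category) (X : C) : is_iso (idm X).
Proof. exists (idm X); now rewrite comp_idl. Qed.

Lemma is_iso_comp (C : Category) (X Y Z : C) (g : Hom Y Z) (f : Hom X Y) :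
  is_iso g -> is_iso f -> is_iso (g ∘ f).
Proof.
intros [g' [Hg1 Hg2]] [f' [Hf1 Hf2]]; exists (f' ∘ g'); split.
- now rewrite compA, <- (compA f' g' g), Hg1, comp_idr.
- now rewrite compA, <- (compA g f f'), Hf2, comp_idr.
Qed.

Lemma is_iso_fmap (C D : Category) (F : Functor C D) (X Y : C) (f : Hom X Y) :
  is_iso f -> is_iso (fmap F f).
Proof.
intros [g [H1 H2]]; exists (fmap F g); split.
- now rewrite <- fmap_comp, H1, fmap_id.
- now rewrite <- fmap_comp, H2, fmap_id.
Qed.

Program Definition id_smf (C : SemiMonoidalCategory) :
    SemiMonoidalFunctor C C :=
  {| smf_functor := id_functor C; mu := fun X Y => idm (X ⊗ Y) |}.
Next Obligation. cbn; intros; apply is_iso_id. Qed.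
Next Obligation. cbn; intros; now rewrite comp_idl, comp_idr. Qed.
Next Obligation. cbn; intros; now rewrite !bimap_id, !comp_idr, !comp_idl. Qed.

Program Definition comp_smf (C D E : SemiMonoidalCategory)
    (G : SemiMonoidalFunctor D E) (F : SemiMonoidalFunctor C D) :
    SemiMonoidalFunctor C E :=
  {| smf_functor := comp_functor G F;
     mu := fun X Y => fmap G (mu F X Y) ∘ mu G (F X) (F Y) |}.
Next Obligation.
cbn; intros.
apply is_iso_comp; [apply is_iso_fmap|]; apply mu_iso.
Qed.
Next Obligation.
cbn; intros.
now rewrite <- compA, mu_natural, !compA, <- !fmap_comp, mu_natural.
Qed.
Next Obligation.
cbn; intros.
set (a := assoc (G (F X)) (G (F Y)) (G (F Z))).
rewrite <- (comp_idl (idm (G (F X)))), <- (comp_idl (idm (G (F Z)))).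
rewrite !bimap_comp, <- !(fmap_id G).
rewrite !compA.
rewrite <- (compA _ (mu G (F X) (F (Y ⊗ Z)))), mu_natural.
rewrite <- (compA _ (mu G (F (X ⊗ Y)) (F Z))), mu_natural.
rewrite !compA, <- !fmap_comp, mu_assoc.
rewrite !fmap_comp, !fmap_id.
pose proof (mu_assoc G (F X) (F Y) (F Z)) as H.
rewrite <- !compA in H; rewrite <- !compA; unfold a; now rewrite H.
Qed.

Record SemiMonoidalNatIso (C D : SemiMonoidalCategory)
    (F G : SemiMonoidalFunctor C D) := {
  component : forall X : C, Hom (F X) (G X);
  component_iso : forall X, is_iso (component X);
  component_natural : forall (X Y : C) (f : Hom X Y),
    component Y ∘ fmap F f = fmap G f ∘ component X;
  component_tensor : forall X Y : C,
    component (X ⊗ Y) ∘ mu F X Y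
    = mu G X Y ∘ (component X ⊗₁ component Y)
}.

Definition semi_monoidally_equivalent (C D : SemiMonoidalCategory) : Prop :=
  exists (F : SemiMonoidalFunctor C D) (G : SemiMonoidalFunctor D C),
    inhabited (SemiMonoidalNatIso (comp_smf G F) (id_smf C)) /\
    inhabited (SemiMonoidalNatIso (comp_smf F G) (id_smf D)).

Inductive generated_by (C : SemiMonoidalCategory) (S : C) : C -> Prop :=
| generated_base : generated_by S S
| generated_tensor (X Y : C) :
    generated_by S X -> generated_by S Y -> generated_by S (X ⊗ Y).

Definition monogenic (C : SemiMonoidalCategory) (S : C) : Prop :=
  forall X : C, generated_by S X.

Definition self_similar (C : SemiMonoidalCategory) (S : C) : Prop :=
  exists f : Hom (S ⊗ S) S, is_iso f.

Definition is_semi_monoidal_monoid (M : SemiMonoidalCategory) : Prop :=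
  exists x : M, forall y : M, y = x.

(* Main.v *)
Require Import Defs.
From Stdlib Require Import ClassicalEpsilon.

(** In a monogenic category with [k : S ⊗ S ≅ S], every object is isomorphic
    to [S]: this holds for [S], and if [X ≅ S] and [Y ≅ S] then
    [X ⊗ Y ≅ S ⊗ S ≅ S] ([iso_to_generator]).  Hence the inclusion of the full
    subcategory on [S] is an equivalence of categories, and it only remains to
    put a semi-monoidal structure on the monoid [Hom S S] that makes this
    equivalence semi-monoidal.

    The object [S] is not closed under [⊗] on the nose, but conjugation by [k]
    brings everything back to it: the tensor of [f] and [g] is
    [k ∘ (f ⊗₁ g) ∘ k⁻¹], and the associator is [assoc S S S] with both of its
    bracketings of [S ⊗ S ⊗ S] collapsed onto [S] by [k]
    ([endo_semi_monoidal]).  The inclusion is then semi-monoidal with structure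
    map [k] ([endo_inclusion]).

    Any choice of isomorphisms [φ X : X ≅ S] gives an inverse functor
    [f ↦ φ Y ∘ f ∘ (φ X)⁻¹] ([endo_retraction]).  The choice need not respect
    the tensor: the structure map [φ (X ⊗ Y) ∘ (φ X ⊗ φ Y)⁻¹ ∘ k⁻¹] measures
    the discrepancy, and it is the only one for which [φ] is a semi-monoidal
    natural isomorphism. *)

Set Implicit Arguments.
Unset Strict Implicit.
Unset Printing Implicit Defensive.
Local Open Scope cat_scope.

(** * Isomorphisms with a chosen inverse *)

(** Unlike [is_iso], the inverse is data, since it enters the definition of
    the tensor and of the functors below. *)
Record Iso (C : Category) (X Y : C) := {
  to : Hom X Y;
  from : Hom Y X;
  from_to : from ∘ to = idm X;
  to_from : to ∘ from = idm Y
}.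

Lemma is_iso_to (C : Category) (X Y : C) (i : Iso X Y) : is_iso (to i).
Proof. exists (from i); split; [apply from_to | apply to_from]. Qed.

Lemma is_iso_from (C : Category) (X Y : C) (i : Iso X Y) : is_iso (from i).
Proof. exists (to i); split; [apply to_from | apply from_to]. Qed.

Lemma is_iso_inhabited (C : Category) (X Y : C) (f : Hom X Y) :
  is_iso f -> inhabited (Iso X Y).
Proof. intros [g [gf fg]]; exact (inhabits (Build_Iso gf fg)). Qed.

Lemma from_toK (C : Category) (W X Y : C) (i : Iso X Y) (f : Hom W X) :
  from i ∘ (to i ∘ f) = f.
Proof. now rewrite compA, from_to, comp_idl. Qed.

Lemma to_fromK (C : Category) (W X Y : C) (i : Iso X Y) (f : Hom W Y) :
  to i ∘ (from i ∘ f) = f.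
Proof. now rewrite compA, to_from, comp_idl. Qed.

Lemma is_iso_bimap (C : SemiMonoidalCategory) (X X' Y Y' : C)
    (f : Hom X X') (g : Hom Y Y') :
  is_iso f -> is_iso g -> is_iso (f ⊗₁ g).
Proof.
intros [f' [Hf1 Hf2]] [g' [Hg1 Hg2]]; exists (f' ⊗₁ g').
now rewrite <- !bimap_comp, Hf1, Hf2, Hg1, Hg2, !bimap_id.
Qed.

(** The interchange law, naturality of the associator and the pentagon are
    stated here with a trailing factor [u], so that they rewrite inside
    right-nested composites. *)
Lemma bimap_compK (C : SemiMonoidalCategory) (W X X' X'' Y Y' Y'' : C)
    (f' : Hom X' X'') (f : Hom X X') (g' : Hom Y' Y'') (g : Hom Y Y')
    (u : Hom W (X ⊗ Y)) :
  (f' ⊗₁ g') ∘ ((f ⊗₁ g) ∘ u) = ((f' ∘ f) ⊗₁ (g' ∘ g)) ∘ u.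
Proof. now rewrite compA, bimap_comp. Qed.

(** Naturality, applicable even when the right-hand tensorand has been merged
    with a further morphism [v]: the part of shape [g ⊗₁ h] passes the
    associator and [v] stays behind. *)
Lemma assoc_slide (C : SemiMonoidalCategory) (V W X X' Y Y' Z Z' : C)
    (f : Hom X X') (g : Hom Y Y') (h : Hom Z Z')
    (v : Hom V (Y ⊗ Z)) (u : Hom W (X ⊗ V)) :
  assoc X' Y' Z' ∘ ((f ⊗₁ ((g ⊗₁ h) ∘ v)) ∘ u)
  = ((f ⊗₁ g) ⊗₁ h) ∘ (assoc X Y Z ∘ ((idm X ⊗₁ v) ∘ u)).
Proof.
rewrite (compA _ (assoc X Y Z)), <- assoc_natural, <- compA, bimap_compK.
now rewrite comp_idr.
Qed.

Lemma pentagonK (C : SemiMonoidalCategory) (V W X Y Z : C)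
    (u : Hom V (W ⊗ (X ⊗ (Y ⊗ Z)))) :
  assoc (W ⊗ X) Y Z ∘ (assoc W X (Y ⊗ Z) ∘ u)
  = (assoc W X Y ⊗₁ idm Z)
    ∘ (assoc W (X ⊗ Y) Z ∘ ((idm W ⊗₁ assoc X Y Z) ∘ u)).
Proof. now rewrite !compA, pentagon. Qed.

(** Right-nests composites, merges tensors by interchange and cancels inverse
    pairs, so that a composite is left as an alternation of associators and
    single tensors. *)
Ltac merge :=
  repeat first
    [ rewrite <- compA | rewrite comp_idl | rewrite comp_idr
    | rewrite from_toK | rewrite to_fromK
    | rewrite from_to | rewrite to_from
    | rewrite bimap_compK | rewrite <- bimap_comp | rewrite bimap_id ].

(** * The semi-monoidal monoid on the endomorphisms of a self-similar object *)

Section EndomorphismMonoid.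
Context (C : SemiMonoidalCategory) (S : C) (k : Iso (S ⊗ S) S).

Definition endo_category : Category :=
  {| Ob := unit;
     Hom := fun _ _ => Hom S S;
     idm := fun _ => idm S;
     comp := fun _ _ _ g f => g ∘ f;
     comp_idl := fun _ _ f => comp_idl f;
     comp_idr := fun _ _ f => comp_idr f;
     compA := fun _ _ _ _ h g f => compA h g f |}.

Definition endo_bimap (f g : Hom S S) : Hom S S :=
  to k ∘ ((f ⊗₁ g) ∘ from k).

Program Definition endo_tensor :
    Functor (prod_category endo_category endo_category) endo_category :=
  {| fobj := fun _ => tt;
     fmap := fun _ _ fg => endo_bimap (fst fg) (snd fg) |}.
Next Obligation. cbn; intros; unfold endo_bimap; now merge. Qed.
Next Obligation. cbn; intros; unfold endo_bimap; now merge. Qed.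

Definition endo_assoc : Hom S S :=
  to k ∘ ((to k ⊗₁ idm S)
    ∘ (assoc S S S ∘ ((idm S ⊗₁ from k) ∘ from k))).

Lemma endo_assoc_iso : is_iso endo_assoc.
Proof.
repeat first [ apply is_iso_comp | apply is_iso_bimap | apply is_iso_to
             | apply is_iso_from | apply is_iso_id | apply assoc_iso ].
Qed.

Lemma endo_assoc_natural (f g h : Hom S S) :
  endo_assoc ∘ endo_bimap f (endo_bimap g h)
  = endo_bimap (endo_bimap f g) h ∘ endo_assoc.
Proof. unfold endo_assoc, endo_bimap; merge; rewrite assoc_slide; now merge. Qed.

(** The two sides reduce to those of the pentagon for [S, S, S, S], collapsed
    onto [S] at both ends by [k].  On the left the tensor [to k ⊗₁ from k]
    stands between the two associators; its factors act on different tensorands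
    and are carried outwards past one associator each. *)
Lemma endo_pentagon :
  endo_assoc ∘ endo_assoc
  = endo_bimap endo_assoc (idm S) ∘ endo_assoc ∘ endo_bimap (idm S) endo_assoc.
Proof.
unfold endo_assoc, endo_bimap; merge.
rewrite assoc_slide; merge.
(* The identities give both factors a shape on which [assoc_slide] acts. *)
assert (split : to k ⊗₁ from k
    = (to k ⊗₁ ((idm S ⊗₁ idm S) ∘ idm (S ⊗ S)))
      ∘ ((idm S ⊗₁ idm S) ⊗₁ from k)) by now merge.
rewrite split, <- compA, <- assoc_slide, assoc_slide; merge.
rewrite pentagonK; now merge.
Qed.

(** Conjugation by [k] is injective, so faithfulness is inherited from [S]. *)
Lemma endo_faithful (x : endo_category) : faithful_object endo_tensor x.
Proof.
assert (bimap_inj : forall f g f' g' : Hom S S,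
    endo_bimap f g = endo_bimap f' g' -> f ⊗₁ g = f' ⊗₁ g').
{ intros f g f' g' E.
  apply (f_equal (fun u => from k ∘ (u ∘ to k))) in E.
  revert E; unfold endo_bimap; now merge. }
destruct (all_faithful S) as [Hl Hr].
split; intros X Y f g E; [apply Hl | apply Hr]; now apply bimap_inj.
Qed.

Definition endo_semi_monoidal : SemiMonoidalCategory :=
  {| smc_cat := endo_category;
     tensor := endo_tensor;
     assoc := fun _ _ _ => endo_assoc : Hom (c := endo_category) tt tt;
     assoc_iso := fun _ _ _ => endo_assoc_iso;
     assoc_natural := fun _ _ _ _ _ _ f g h => endo_assoc_natural f g h;
     pentagon := fun _ _ _ _ => endo_pentagon;
     all_faithful := endo_faithful |}.

Lemma endo_is_monoid : is_semi_monoidal_monoid endo_semi_monoidal.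
Proof. exists tt; now intros []. Qed.

(** * The equivalence *)

Definition endo_inclusion_functor : Functor endo_semi_monoidal C :=
  {| fobj := fun _ : endo_semi_monoidal => S;
     fmap := fun _ _ f => f;
     fmap_id := fun _ => eq_refl;
     fmap_comp := fun _ _ _ _ _ => eq_refl |}.

Program Definition endo_inclusion : SemiMonoidalFunctor endo_semi_monoidal C :=
  {| smf_functor := endo_inclusion_functor; mu := fun _ _ => to k |}.
Next Obligation. apply is_iso_to. Qed.
Next Obligation. cbn; intros; unfold endo_bimap; now merge. Qed.
Next Obligation. cbn; intros; unfold endo_assoc; now merge. Qed.

Context (φ : forall X : C, Iso X S).

Program Definition endo_retraction_functor : Functor C endo_semi_monoidal :=
  {| fobj := fun _ => tt : endo_semi_monoidal;
     fmap := fun X Y f => to (φ Y) ∘ (f ∘ from (φ X)) |}.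
Next Obligation. cbn; intros; now merge. Qed.
Next Obligation. cbn; intros; now merge. Qed.

(** The value forced by requiring the family [from (φ X)] to be compatible with the tensor;
    see [inclusion_retraction]. *)
Definition endo_retraction_mu (X Y : C) : Hom S S :=
  to (φ (X ⊗ Y)) ∘ ((from (φ X) ⊗₁ from (φ Y)) ∘ from k).

Program Definition endo_retraction : SemiMonoidalFunctor C endo_semi_monoidal :=
  {| smf_functor := endo_retraction_functor; mu := endo_retraction_mu |}.
Next Obligation.
intros; change (is_iso (endo_retraction_mu X Y)); unfold endo_retraction_mu.
repeat first [ apply is_iso_comp | apply is_iso_bimap | apply is_iso_to
             | apply is_iso_from ].
Qed.
Next Obligation.
cbn; intros; unfold endo_retraction_mu, endo_bimap; now merge.
Qed.
Next Obligation.
cbn; intros; unfold endo_retraction_mu, endo_bimap, endo_assoc; merge.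
rewrite assoc_slide; now merge.
Qed.

Program Definition inclusion_retraction :
    SemiMonoidalNatIso (comp_smf endo_inclusion endo_retraction) (id_smf C) :=
  {| component := fun X => from (φ X) |}.
Next Obligation. cbn; intros; apply is_iso_from. Qed.
Next Obligation. cbn; intros; now merge. Qed.
Next Obligation. cbn; intros; unfold endo_retraction_mu; now merge. Qed.

(** Retracting an endomorphism of [S] conjugates it by [φ S], which need not be
    the identity; hence the component [from (φ S)]. *)
Program Definition retraction_inclusion :
    SemiMonoidalNatIso (comp_smf endo_retraction endo_inclusion)
      (id_smf endo_semi_monoidal) :=
  {| component := fun _ => from (φ S) |}.
Next Obligation. intros; exact (is_iso_from (φ S)). Qed.
Next Obligation. cbn; intros; now merge. Qed.
Next Obligation.
cbn; intros; unfold endo_retraction_mu, endo_bimap; now merge.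
Qed.

Lemma equivalent_endo_semi_monoidal :
  semi_monoidally_equivalent C endo_semi_monoidal.
Proof.
exists endo_retraction, endo_inclusion; split; constructor.
- apply inclusion_retraction.
- apply retraction_inclusion.
Qed.

End EndomorphismMonoid.

(** * Monogenic categories *)

Lemma iso_to_generator (C : SemiMonoidalCategory) (S X : C) :
  self_similar S -> generated_by S X -> exists f : Hom X S, is_iso f.
Proof.
intros [k Hk]; induction 1 as [|X Y _ [f Hf] _ [g Hg]].
- exists (idm S); apply is_iso_id.
- exists (k ∘ (f ⊗₁ g)); apply is_iso_comp; [|apply is_iso_bimap]; assumption.
Qed.

Theorem corollary7p20 (C : SemiMonoidalCategory) (S : C)
  (HS : monogenic S) (Hss : self_similar S) :
  exists M : SemiMonoidalCategory,
    is_semi_monoidal_monoid M /\ semi_monoidally_equivalent C M.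
Proof.
assert (iso : forall X : C, inhabited (Iso X S)).
{ intros X; destruct (iso_to_generator Hss (HS X)) as [f Hf].
  exact (is_iso_inhabited Hf). }
(* [generated_by] is a proposition, so no isomorphism can be computed from a
   derivation; one is picked by choice for each object. *)
assert (φ : forall X : C, Iso X S).
{ intros X; exact (epsilon (iso X) (fun _ => True)). }
destruct Hss as [f Hf], (is_iso_inhabited Hf) as [k].
exists (endo_semi_monoidal k); split.
- apply endo_is_monoid.
- exact (equivalent_endo_semi_monoidal k φ).
Qed.
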